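(* Let $X$ and $Y$ be Banach spaces and let $T\in B(X)$ and $S\in B(Y)$ be non-zero compact operators. If $T$ and $S$ are equivalent after extension, then $I_T=I_S$, i.e. $I_T(Z_1,Z_2)=I_S(Z_1,Z_2)$ for all Banach spaces $Z_1,Z_2$.
   Context: All Banach spaces are complex; $B(X,Y)$ denotes the bounded linear operators from $X$ to $Y$, $B(X)=B(X,X)$; invertibility means having a bounded inverse. $X\oplus Y$ denotes the $\ell^2$-direct sum and $\mathrm{id}_X$ the identity on $X$. Operators $T\in B(X)$ and $S\in B(Y)$ are called equivalent after extension if there exist Banach spaces $X'$, $Y'$ and invertible operators $E\in B(Y\oplus Y',X\oplus X')$ and $F\in B(X\oplus X',Y\oplus Y')$ with $\begin{bmatrix}T&0\\0&\mathrm{id}_{X'}\end{bmatrix}=E\begin{bmatrix}S&0\\0&\mathrm{id}_{Y'}\end{bmatrix}F$. For an operator $T\in B(X,Y)$ and Banach spaces $Z_1,Z_2$, define $I_T(Z_1,Z_2)=\bigcup_{n\in\mathbb N}\{\sum_{j=1}^n R_jTR_j' : R_j\in B(Y,Z_2),\ R_j'\in B(Z_1,X)\}$; the operator ideal generated by $T$ is the class $I_T=\bigcup_{Z_1,Z_2}I_T(Z_1,Z_2)$. *)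

(* Defs.v *)
From Stdlib Require Import Reals.
Open Scope R_scope.

Record Cplx := mkC { Re : R; Im : R }.
Definition C0 : Cplx := mkC 0 0.
Definition C1 : Cplx := mkC 1 0.
Definition Cadd (a b : Cplx) : Cplx := mkC (Re a + Re b) (Im a + Im b).
Definition Cmul (a b : Cplx) : Cplx :=
  mkC (Re a * Re b - Im a * Im b) (Re a * Im b + Im a * Re b).
Definition Cabs (a : Cplx) : R := sqrt (Re a * Re a + Im a * Im a).

Record NData := {
  car :> Type;
  vzero : car;
  vadd : car -> car -> car;
  vopp : car -> car;
  vscal : Cplx -> car -> car;
  vnorm : car -> R }.
Arguments vzero {_}. Arguments vadd {_}. Arguments vopp {_}.
Arguments vscal {_}. Arguments vnorm {_}.

Definition converges (X : NData) (u : nat -> X) (l : X) : Prop :=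
  forall eps, 0 < eps -> exists N, forall n, (N <= n)%nat ->
    vnorm (vadd (u n) (vopp l)) < eps.

Definition cauchy (X : NData) (u : nat -> X) : Prop :=
  forall eps, 0 < eps -> exists N, forall n m, (N <= n)%nat -> (N <= m)%nat ->
    vnorm (vadd (u n) (vopp (u m))) < eps.

Record Banach := {
  bdata :> NData;
  add_assoc : forall x y z : bdata, vadd x (vadd y z) = vadd (vadd x y) z;
  add_comm : forall x y : bdata, vadd x y = vadd y x;
  add_zero : forall x : bdata, vadd x vzero = x;
  add_opp : forall x : bdata, vadd x (vopp x) = vzero;
  scal_one : forall x : bdata, vscal C1 x = x;
  scal_assoc : forall (a b : Cplx) (x : bdata), vscal a (vscal b x) = vscal (Cmul a b) x;
  scal_addl : forall (a b : Cplx) (x : bdata), vscal (Cadd a b) x = vadd (vscal a x) (vscal b x);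
  scal_addr : forall (a : Cplx) (x y : bdata), vscal a (vadd x y) = vadd (vscal a x) (vscal a y);
  norm_def : forall x : bdata, vnorm x = 0 -> x = vzero;
  norm_scal : forall (a : Cplx) (x : bdata), vnorm (vscal a x) = Cabs a * vnorm x;
  norm_triangle : forall x y : bdata, vnorm (vadd x y) <= vnorm x + vnorm y;
  complete : forall u : nat -> bdata, cauchy bdata u -> exists l, converges bdata u l }.

Definition is_bounded_linear (X Y : NData) (f : X -> Y) : Prop :=
  (forall x y, f (vadd x y) = vadd (f x) (f y)) /\
  (forall (a : Cplx) x, f (vscal a x) = vscal a (f x)) /\
  (exists M, forall x, vnorm (f x) <= M * vnorm x).

Definition is_invertible (X Y : NData) (f : X -> Y) : Prop :=
  is_bounded_linear X Y f /\
  exists g : Y -> X, is_bounded_linear Y X g /\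
    (forall x, g (f x) = x) /\ (forall y, f (g y) = y).

Definition is_compact_op (X Y : NData) (f : X -> Y) : Prop :=
  is_bounded_linear X Y f /\
  forall u : nat -> X, (forall n, vnorm (u n) <= 1) ->
    exists (phi : nat -> nat) (l : Y),
      (forall n, (phi n < phi (S n))%nat) /\ converges Y (fun n => f (u (phi n))) l.

Definition nonzero_op (X Y : NData) (f : X -> Y) : Prop := exists x, f x <> vzero.

Definition dsum (X Y : NData) : NData := {|
  car := (X * Y)%type;
  vzero := (vzero, vzero);
  vadd := fun p q => (vadd (fst p) (fst q), vadd (snd p) (snd q));
  vopp := fun p => (vopp (fst p), vopp (snd p));
  vscal := fun a p => (vscal a (fst p), vscal a (snd p));
  vnorm := fun p => sqrt (vnorm (fst p) * vnorm (fst p) + vnorm (snd p) * vnorm (snd p)) |}.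

Definition diag_id (X X' : NData) (T : X -> X) : dsum X X' -> dsum X X' :=
  fun p => (T (fst p), snd p).

Definition equiv_after_ext (X Y : Banach) (T : X -> X) (S : Y -> Y) : Prop :=
  exists (X' Y' : Banach) (E : dsum Y Y' -> dsum X X') (F : dsum X X' -> dsum Y Y'),
    is_invertible (dsum Y Y') (dsum X X') E /\
    is_invertible (dsum X X') (dsum Y Y') F /\
    forall p : dsum X X', diag_id X X' T p = E (diag_id Y Y' S (F p)).

Fixpoint vsum (X : NData) (n : nat) (g : nat -> X) : X :=
  match n with
  | O => vzero
  | S k => vadd (vsum X k g) (g k)
  end.

Definition in_ideal (X Y : Banach) (T : X -> Y) (Z1 Z2 : Banach) (A : Z1 -> Z2) : Prop :=
  exists (n : nat) (Rs : nat -> Y -> Z2) (Rs' : nat -> Z1 -> X),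
    (forall j, is_bounded_linear Y Z2 (Rs j)) /\
    (forall j, is_bounded_linear Z1 X (Rs' j)) /\
    forall z, A z = vsum Z2 n (fun j => Rs j (T (Rs' j z))).

(* Main.v *)
(* The corner of the equivalence after extension gives T = A + KT with A in I_S
   and K = TN compact. By Riesz theory 1 - K becomes left invertible after a
   finite rank perturbation W: if B (1 - K - W) = 1, then T = BA - BWT. The
   operator WT has finite rank, hence lies in I_S because S is non-zero, by the
   Hahn-Banach theorem. So T lies in I_S, and the hypotheses are symmetric. *)

From Stdlib Require Import Reals Lra Lia List ClassicalEpsilon.
From mathcomp Require boolp classical_sets.
Require Import Defs.

(** The relation T = A + KT reads (1 - K)T = A, and the obstacle is the possible kernel of 1 - K.
    The perturbation W only has to restore injectivity: a left inverse of 1 - K - W is all that is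
    used, so neither the Fredholm index nor a complement of the kernel has to be set up, and finite
    dimension of the kernel is replaced by a chain argument. The spaces X' and Y' carry no
    compactness: the term E12 F21 passes through Y', where the middle operator is the identity. It
    becomes compact because both off-diagonal corners factor through T once the inverses of E and F
    are brought in; this is the origin of N. The Hahn-Banach theorem serves twice. One functional
    cuts down a kernel in the construction of W; another, not vanishing on the range of S, recovers
    every rank-one operator from S. *)

Local Notation vsub x y := (vadd x (vopp y)).
Local Notation rscal r := (vscal (mkC r 0)).

(** * Linear identities *)

Lemma Cplx_eq (a b : Cplx) : Re a = Re b -> Im a = Im b -> a = b.
Proof. destruct a, b; simpl; intros -> ->; reflexivity. Qed.

Lemma Cabs_real (r : R) : Cabs (mkC r 0) = Rabs r.
Proof.
  unfold Cabs; simpl. rewrite <- sqrt_Rsqr_abs. f_equal. unfold Rsqr; ring.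
Qed.

Lemma vadd_cancel (X : Banach) (x y z : X) : vadd x y = vadd x z -> y = z.
Proof.
  intros H.
  assert (E : forall w : X, vadd (vopp x) (vadd x w) = w).
  { intros w. rewrite add_assoc, (add_comm X (vopp x)), add_opp, add_comm.
    apply add_zero. }
  rewrite <- (E y), <- (E z), H. reflexivity.
Qed.

Lemma vscal_C0 (X : Banach) (x : X) : vscal C0 x = vzero.
Proof.
  apply (vadd_cancel X (vscal C0 x)). rewrite <- scal_addl, add_zero.
  f_equal. apply Cplx_eq; simpl; ring.
Qed.

Lemma vscal_zero (X : Banach) (a : Cplx) : vscal a (vzero : X) = vzero.
Proof.
  rewrite <- (vscal_C0 X vzero), scal_assoc. f_equal. apply Cplx_eq; simpl; ring.
Qed.

Lemma vopp_scal (X : Banach) (x : X) : vopp x = rscal (-1) x.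
Proof.
  apply (vadd_cancel X x). rewrite add_opp.
  rewrite <- (scal_one X x) at 1. rewrite <- scal_addl.
  rewrite <- (vscal_C0 X x). f_equal. apply Cplx_eq; simpl; ring.
Qed.

(** Syntax for proof by reflection: two linear combinations of the same atoms agree as soon as their
    coefficients do, which leaves real identities for [ring] or [field]. *)
Inductive lexp :=
  | LVar (n : nat) | LZero | LAdd (a b : lexp) | LOpp (a : lexp)
  | LScal (c : Cplx) (a : lexp).

Fixpoint leval (X : Banach) (env : list X) (e : lexp) : X :=
  match e with
  | LVar n => nth n env vzero
  | LZero => vzero
  | LAdd a b => vadd (leval X env a) (leval X env b)
  | LOpp a => vopp (leval X env a)
  | LScal c a => vscal c (leval X env a)
  end.

Fixpoint lcoef (e : lexp) (n : nat) : Cplx :=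
  match e with
  | LVar m => if Nat.eqb m n then C1 else C0
  | LZero => C0
  | LAdd a b => Cadd (lcoef a n) (lcoef b n)
  | LOpp a => Cmul (mkC (-1) 0) (lcoef a n)
  | LScal c a => Cmul c (lcoef a n)
  end.

Fixpoint lsum (X : Banach) (env : list X) (c : nat -> Cplx) : X :=
  match env with
  | nil => vzero
  | x :: env' => vadd (vscal (c 0%nat) x) (lsum X env' (fun n => c (S n)))
  end.

Lemma lsum_zero (X : Banach) (env : list X) (c : nat -> Cplx) :
  (forall n, c n = C0) -> lsum X env c = vzero.
Proof.
  revert c; induction env as [|x env IH]; intros c H; simpl; [reflexivity|].
  rewrite IH by (intros; apply H). rewrite H, vscal_C0. apply add_zero.
Qed.

Lemma lsum_add (X : Banach) (env : list X) (c d : nat -> Cplx) :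
  lsum X env (fun n => Cadd (c n) (d n)) = vadd (lsum X env c) (lsum X env d).
Proof.
  revert c d; induction env as [|x env IH]; intros c d; simpl.
  - symmetry; apply add_zero.
  - rewrite IH, scal_addl, !add_assoc. f_equal.
    rewrite <- !add_assoc. f_equal. apply add_comm.
Qed.

Lemma lsum_scal (X : Banach) (env : list X) (a : Cplx) (c : nat -> Cplx) :
  lsum X env (fun n => Cmul a (c n)) = vscal a (lsum X env c).
Proof.
  revert c; induction env as [|x env IH]; intros c; simpl.
  - symmetry; apply vscal_zero.
  - rewrite IH, scal_addr, scal_assoc. reflexivity.
Qed.

Lemma lsum_var (X : Banach) (env : list X) (m : nat) :
  lsum X env (fun n => if Nat.eqb m n then C1 else C0) = nth m env vzero.
Proof.
  revert m; induction env as [|x env IH]; intros [|m]; simpl; try reflexivity.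
  - rewrite scal_one, lsum_zero by reflexivity. apply add_zero.
  - rewrite IH, vscal_C0, add_comm. apply add_zero.
Qed.

Lemma leval_lsum (X : Banach) (env : list X) (e : lexp) :
  leval X env e = lsum X env (lcoef e).
Proof.
  induction e as [m| |a IHa b IHb|a IHa|c a IHa]; simpl.
  - symmetry; apply lsum_var.
  - symmetry; apply lsum_zero; reflexivity.
  - rewrite IHa, IHb. symmetry; apply lsum_add.
  - rewrite vopp_scal, IHa. symmetry; apply lsum_scal.
  - rewrite IHa. symmetry; apply lsum_scal.
Qed.

(** Recursion on the environment lets [simpl] unfold this into a finite conjunction with one
    equation per atom. *)
Fixpoint same_coefs (X : Banach) (env : list X) (c d : nat -> Cplx) : Prop :=
  match env with
  | nil => True
  | _ :: env' =>
      c 0%nat = d 0%nat /\ same_coefs X env' (fun n => c (S n)) (fun n => d (S n))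
  end.

Lemma leval_eq (X : Banach) (env : list X) (e1 e2 : lexp) :
  same_coefs X env (lcoef e1) (lcoef e2) -> leval X env e1 = leval X env e2.
Proof.
  intros H; rewrite !leval_lsum. revert H. generalize (lcoef e1) (lcoef e2).
  induction env as [|x env IH]; intros c d H; simpl; [reflexivity|].
  destruct H as [H1 H2]. rewrite H1, (IH _ _ H2). reflexivity.
Qed.

(** [constr_eq] is a tactic, so a dummy [match] runs it while the index term is being built; its
    failure falls through to the next branch. *)
Ltac env_index x env :=
  lazymatch env with
  | ?y :: ?env' =>
      match constr:(Set) with
      | _ => let _ := match constr:(Set) with _ => constr_eq x y end in constr:(0%nat)
      | _ => let n := env_index x env' in constr:(S n)
      end
  end.

Ltac env_insert x env :=
  match constr:(Set) with
  | _ => let _ := env_index x env in env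
  | _ => constr:(x :: env)
  end.

Ltac env_collect X e env :=
  lazymatch e with
  | vadd ?a ?b => let env := env_collect X a env in env_collect X b env
  | vopp ?a => env_collect X a env
  | vscal _ ?a => env_collect X a env
  | vzero => env
  | _ => env_insert e env
  end.

(** A separate pass after collection, since inserting an atom at the front shifts all earlier
    indices. *)
Ltac lreify e env :=
  lazymatch e with
  | vadd ?a ?b =>
      let a := lreify a env in let b := lreify b env in constr:(LAdd a b)
  | vopp ?a => let a := lreify a env in constr:(LOpp a)
  | vscal ?c ?a => let a := lreify a env in constr:(LScal c a)
  | vzero => constr:(LZero)
  | _ => let n := env_index e env in constr:(LVar n)
  end.

(* Reduces an equation between linear combinations to the equality of the
   coefficients of its atoms. *)
Ltac vlin_coefs :=
  lazymatch goal with
  | |- @eq (car (bdata ?X)) ?a ?b =>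
      let env := env_collect X a (@nil (car (bdata X))) in
      let env := env_collect X b env in
      let ea := lreify a env in
      let eb := lreify b env in
      change (leval X env ea = leval X env eb);
      apply leval_eq; simpl; repeat split; apply Cplx_eq; simpl
  end.

Ltac vlin := vlin_coefs; try ring.

(** * Norms and limits *)

Lemma norm_zero (X : Banach) : vnorm (vzero : X) = 0.
Proof.
  rewrite <- (vscal_C0 X vzero), norm_scal. unfold C0.
  rewrite Cabs_real, Rabs_R0. ring.
Qed.

Lemma norm_opp (X : Banach) (x : X) : vnorm (vopp x) = vnorm x.
Proof.
  rewrite vopp_scal, norm_scal, Cabs_real, Rabs_left by lra. ring.
Qed.

(** Not a field of [Banach]; it follows from 0 = |x - x| <= 2 |x|. *)
Lemma norm_nonneg (X : Banach) (x : X) : 0 <= vnorm x.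
Proof.
  generalize (norm_triangle X x (vopp x)).
  rewrite add_opp, norm_zero, norm_opp. lra.
Qed.

Lemma norm_pos (X : Banach) (x : X) : x <> vzero -> 0 < vnorm x.
Proof.
  intros H. destruct (norm_nonneg X x) as [|E]; [assumption|].
  destruct H. apply norm_def. auto.
Qed.

Lemma norm_sub_sym (X : Banach) (x y : X) : vnorm (vsub x y) = vnorm (vsub y x).
Proof. rewrite <- (norm_opp X (vsub y x)). f_equal. vlin. Qed.

Lemma norm_sub_triangle (X : Banach) (x y z : X) :
  vnorm (vsub x z) <= vnorm (vsub x y) + vnorm (vsub y z).
Proof.
  replace (vsub x z) with (vadd (vsub x y) (vsub y z)) by vlin.
  apply norm_triangle.
Qed.

Lemma norm_sub_lower (X : Banach) (x y : X) : vnorm x - vnorm y <= vnorm (vsub x y).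
Proof.
  generalize (norm_triangle X (vsub x y) y).
  replace (vadd (vsub x y) y) with x by vlin. lra.
Qed.

Lemma sub_eq_zero (X : Banach) (x y : X) : vsub x y = vzero -> x = y.
Proof.
  intros H. replace x with (vadd (vsub x y) y) by vlin. rewrite H. vlin.
Qed.

(** * Subsequences and limits *)

Definition extraction (phi : nat -> nat) : Prop := forall n, (phi n < phi (S n))%nat.

Lemma extraction_mono (phi : nat -> nat) :
  extraction phi -> forall n m, (n < m)%nat -> (phi n < phi m)%nat.
Proof.
  intros H n m L. induction L as [|m L IH]; [apply H|].
  specialize (H m). lia.
Qed.

Lemma extraction_ge (phi : nat -> nat) : extraction phi -> forall n, (n <= phi n)%nat.
Proof.
  intros H n. induction n as [|n IH]; [lia|]. specialize (H n). lia.
Qed.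

Lemma extraction_comp (phi psi : nat -> nat) :
  extraction phi -> extraction psi -> extraction (fun n => phi (psi n)).
Proof. intros H1 H2 n. apply extraction_mono; auto. Qed.

Lemma converges_sub (X : Banach) (u : nat -> X) (l : X) (phi : nat -> nat) :
  extraction phi -> converges X u l -> converges X (fun n => u (phi n)) l.
Proof.
  intros H Hu eps He. destruct (Hu eps He) as [N HN]. exists N. intros n Hn.
  apply HN. generalize (extraction_ge phi H n). lia.
Qed.

Lemma converges_ext (X : Banach) (u v : nat -> X) (l : X) :
  (forall n, u n = v n) -> converges X u l -> converges X v l.
Proof.
  intros H Hu eps He. destruct (Hu eps He) as [N HN]. exists N. intros n Hn.
  rewrite <- H. auto.
Qed.

Lemma converges_add (X : Banach) (u v : nat -> X) (l m : X) :
  converges X u l -> converges X v m ->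
  converges X (fun n => vadd (u n) (v n)) (vadd l m).
Proof.
  intros Hu Hv eps He.
  destruct (Hu (eps / 2)) as [N HN]; [lra|]. destruct (Hv (eps / 2)) as [M HM]; [lra|].
  exists (N + M)%nat. intros n Hn.
  replace (vsub (vadd (u n) (v n)) (vadd l m))
    with (vadd (vsub (u n) l) (vsub (v n) m)) by vlin.
  eapply Rle_lt_trans; [apply norm_triangle|].
  assert (n >= N)%nat by lia. assert (n >= M)%nat by lia.
  specialize (HN n H). specialize (HM n H0). lra.
Qed.

Lemma converges_unique (X : Banach) (u : nat -> X) (l m : X) :
  converges X u l -> converges X u m -> l = m.
Proof.
  intros Hl Hm. apply sub_eq_zero, NNPP. intros H. apply norm_pos in H.
  destruct (Hl (vnorm (vsub l m) / 2)) as [N HN]; [lra|].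
  destruct (Hm (vnorm (vsub l m) / 2)) as [M HM]; [lra|].
  specialize (HN (N + M)%nat ltac:(lia)). specialize (HM (N + M)%nat ltac:(lia)).
  generalize (norm_sub_triangle X l (u (N + M)%nat) m).
  rewrite (norm_sub_sym X l (u _)). lra.
Qed.

Lemma converges_cauchy (X : Banach) (u : nat -> X) (l : X) :
  converges X u l -> cauchy X u.
Proof.
  intros Hu eps He. destruct (Hu (eps / 2)) as [N HN]; [lra|].
  exists N. intros n m Hn Hm.
  generalize (norm_sub_triangle X (u n) l (u m)). rewrite (norm_sub_sym X l (u _)).
  specialize (HN n Hn) as Hn'. specialize (HN m Hm). lra.
Qed.

Lemma converges_const (X : Banach) (l : X) : converges X (fun _ => l) l.
Proof.
  intros eps He. exists 0%nat. intros. rewrite add_opp, norm_zero. exact He.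
Qed.

Lemma converges_norm_le (X : Banach) (u : nat -> X) (l : X) (r : R) :
  converges X u l -> (forall n, r <= vnorm (u n)) -> r <= vnorm l.
Proof.
  intros Hu H. apply Rnot_lt_le. intros Hr.
  destruct (Hu (r - vnorm l)) as [N HN]; [lra|]. specialize (HN N (le_n _)).
  generalize (norm_sub_lower X (u N) l). specialize (H N). lra.
Qed.

(** * Bounded operators *)

Lemma blin_zero (X Y : Banach) (f : X -> Y) : is_bounded_linear X Y f -> f vzero = vzero.
Proof.
  intros [_ [H _]]. rewrite <- (vscal_C0 X vzero), H. apply vscal_C0.
Qed.

Lemma blin_opp (X Y : Banach) (f : X -> Y) (x : X) :
  is_bounded_linear X Y f -> f (vopp x) = vopp (f x).
Proof. intros [_ [H _]]. rewrite !vopp_scal, H. reflexivity. Qed.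

Lemma blin_sub (X Y : Banach) (f : X -> Y) (x y : X) :
  is_bounded_linear X Y f -> f (vsub x y) = vsub (f x) (f y).
Proof.
  intros H. rewrite (proj1 H), (blin_opp X Y f y H). reflexivity.
Qed.

(** A strictly positive bound can be divided by, as the rescaling arguments below require. *)
Lemma blin_bound (X : Banach) (Y : NData) (f : X -> Y) :
  is_bounded_linear X Y f ->
  exists M, 0 < M /\ forall x, vnorm (f x) <= M * vnorm x.
Proof.
  intros [_ [_ [M HM]]]. exists (Rmax M 1). split.
  - generalize (Rmax_r M 1). lra.
  - intros x. eapply Rle_trans; [apply HM|].
    apply Rmult_le_compat_r; [apply norm_nonneg|apply Rmax_l].
Qed.

Lemma blin_comp (X Z : NData) (Y : Banach) (f : X -> Y) (g : Y -> Z) :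
  is_bounded_linear X Y f -> is_bounded_linear Y Z g ->
  is_bounded_linear X Z (fun x => g (f x)).
Proof.
  intros [fa [fs [M HM]]] Hg. destruct (blin_bound Y Z g Hg) as [N [HN0 HN]].
  destruct Hg as [ga [gs _]]. repeat split.
  - intros. rewrite fa, ga. reflexivity.
  - intros. rewrite fs, gs. reflexivity.
  - exists (N * M). intros x. eapply Rle_trans; [apply HN|].
    rewrite Rmult_assoc. apply Rmult_le_compat_l; [lra|apply HM].
Qed.

Lemma blin_id (X : NData) : is_bounded_linear X X (fun x => x).
Proof. repeat split. exists 1. intros; lra. Qed.

Lemma blin_const_zero (X : NData) (Y : Banach) :
  is_bounded_linear X Y (fun _ => vzero).
Proof.
  repeat split.
  - intros. symmetry; apply add_zero.
  - intros. symmetry; apply vscal_zero.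
  - exists 0. intros. rewrite norm_zero. lra.
Qed.

Lemma blin_add (X : NData) (Y : Banach) (f g : X -> Y) :
  is_bounded_linear X Y f -> is_bounded_linear X Y g ->
  is_bounded_linear X Y (fun x => vadd (f x) (g x)).
Proof.
  intros [fa [fs [M HM]]] [ga [gs [N HN]]]. repeat split.
  - intros. rewrite fa, ga. vlin.
  - intros. rewrite fs, gs. vlin.
  - exists (M + N). intros x. eapply Rle_trans; [apply norm_triangle|].
    rewrite Rmult_plus_distr_r. apply Rplus_le_compat; auto.
Qed.

Lemma blin_opp_op (X : NData) (Y : Banach) (f : X -> Y) :
  is_bounded_linear X Y f -> is_bounded_linear X Y (fun x => vopp (f x)).
Proof.
  intros [fa [fs [M HM]]]. repeat split.
  - intros. rewrite fa. vlin.
  - intros. rewrite fs. vlin.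
  - exists M. intros x. rewrite norm_opp. apply HM.
Qed.

Lemma converges_blin (X Y : Banach) (f : X -> Y) (u : nat -> X) (l : X) :
  is_bounded_linear X Y f -> converges X u l -> converges Y (fun n => f (u n)) (f l).
Proof.
  intros Hf Hu eps He. destruct (blin_bound X Y f Hf) as [M [HM0 HM]].
  destruct (Hu (eps / M)) as [N HN]; [apply Rdiv_lt_0_compat; lra|].
  exists N. intros n Hn. rewrite <- (blin_sub X Y) by assumption.
  eapply Rle_lt_trans; [apply HM|]. specialize (HN n Hn).
  apply (Rmult_lt_compat_l M) in HN; [|lra].
  replace (M * (eps / M)) with eps in HN by (field; lra). exact HN.
Qed.

Definition bounded_below (X Y : Banach) (f : X -> Y) : Prop :=
  exists c, 0 < c /\ forall x, c * vnorm x <= vnorm (f x).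

Lemma bounded_below_comp (X Y Z : Banach) (f : X -> Y) (g : Y -> Z) :
  bounded_below X Y f -> bounded_below Y Z g -> bounded_below X Z (fun x => g (f x)).
Proof.
  intros [c [Hc Hf]] [d [Hd Hg]]. exists (d * c). split; [nra|].
  intros x. eapply Rle_trans; [|apply Hg]. rewrite Rmult_assoc.
  apply Rmult_le_compat_l; [lra|apply Hf].
Qed.

Lemma bounded_below_inj (X Y : Banach) (f : X -> Y) :
  is_bounded_linear X Y f -> bounded_below X Y f -> forall x y, f x = f y -> x = y.
Proof.
  intros Hl [c [Hc Hf]] x y E. apply sub_eq_zero, norm_def.
  specialize (Hf (vsub x y)). rewrite (blin_sub X Y f x y Hl), E, add_opp, norm_zero in Hf.
  generalize (norm_nonneg X (vsub x y)). nra.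
Qed.

(** * Bounded functionals *)

Lemma inf_exists (E : R -> Prop) (b : R) :
  (exists x, E x) -> (forall x, E x -> b <= x) ->
  exists m, (forall x, E x -> m <= x) /\ (forall c, (forall x, E x -> c <= x) -> c <= m).
Proof.
  intros [x0 H0] Hb.
  destruct (completeness (fun x => E (- x))) as [m [H1 H2]].
  - exists (- b). intros x Hx. specialize (Hb _ Hx). lra.
  - exists (- x0). rewrite Ropp_involutive. exact H0.
  - exists (- m). split.
    + intros x Hx. rewrite <- (Ropp_involutive x) in Hx. specialize (H1 _ Hx). lra.
    + intros c Hc. enough (m <= - c) by lra.
      apply H2. intros x Hx. specialize (Hc _ Hx). lra.
Qed.

(** Homogeneity is asked only as an inequality for positive scalars, which passes to infima easily;
    equality follows by using r and 1/r. The bound by the norm also gives q >= -|x|, so pointwise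
    infima of such functionals exist. *)
Definition sublinear (X : Banach) (q : X -> R) : Prop :=
  (forall x y, q (vadd x y) <= q x + q y) /\
  (forall r x, 0 < r -> q (rscal r x) <= r * q x) /\
  (forall x, q x <= vnorm x).

Lemma sublinear_norm (X : Banach) : sublinear X vnorm.
Proof.
  repeat split; intros.
  - apply norm_triangle.
  - rewrite norm_scal, Cabs_real, Rabs_right; lra.
  - lra.
Qed.

Lemma sublinear_zero (X : Banach) (q : X -> R) : sublinear X q -> q vzero = 0.
Proof.
  intros [H1 [_ H3]]. specialize (H1 vzero vzero). specialize (H3 vzero).
  rewrite norm_zero in H3. rewrite add_zero in H1. lra.
Qed.

Lemma sublinear_opp (X : Banach) (q : X -> R) (x : X) :
  sublinear X q -> 0 <= q x + q (vopp x).
Proof.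
  intros H. generalize (proj1 H x (vopp x)).
  rewrite add_opp, (sublinear_zero X q H). auto.
Qed.

Lemma sublinear_scal (X : Banach) (q : X -> R) (r : R) (x : X) :
  sublinear X q -> 0 <= r -> q (rscal r x) = r * q x.
Proof.
  intros H [Hr|<-].
  - destruct H as [_ [H _]]. apply Rle_antisym; [auto|].
    assert (Hi : 0 < / r) by (apply Rinv_0_lt_compat; lra).
    specialize (H (/ r) (rscal r x) Hi).
    replace (rscal (/ r) (rscal r x)) with x in H by (vlin_coefs; field; lra).
    apply (Rmult_le_compat_l r) in H; [|lra].
    rewrite <- Rmult_assoc, Rinv_r in H by lra. lra.
  - replace (rscal 0 x) with (vzero : X) by vlin.
    rewrite (sublinear_zero X q H). ring.
Qed.

(* The witness is [x |-> inf_(t >= 0) (q (x + t a) - t (q a))]. *)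
Lemma sublinear_shift (X : Banach) (q : X -> R) (a : X) :
  sublinear X q ->
  exists q', sublinear X q' /\ (forall x, q' x <= q x) /\
    forall x, q' x <= q (vadd x a) - q a.
Proof.
  intros Hq.
  assert (Hinf : forall x : X, exists m,
    (forall t, 0 <= t -> m <= q (vadd x (rscal t a)) - t * q a) /\
    (forall c, (forall t, 0 <= t -> c <= q (vadd x (rscal t a)) - t * q a) -> c <= m)).
  { intros x.
    destruct (inf_exists
      (fun r => exists t, 0 <= t /\ r = q (vadd x (rscal t a)) - t * q a)
      (- q (vopp x))) as [m [H1 H2]].
    - exists (q (vadd x (rscal 0 a)) - 0 * q a), 0. split; [lra|reflexivity].
    - intros r [t [Ht ->]].
      (* Lower bound of the infimum: t q(a) = q(t a) <= q(x + t a) + q(-x). *)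
      generalize (proj1 Hq (vadd x (rscal t a)) (vopp x)).
      replace (vadd (vadd x (rscal t a)) (vopp x)) with (rscal t a) by vlin.
      rewrite (sublinear_scal X q t a Hq Ht). lra.
    - exists m. split.
      + intros t Ht. apply H1. eauto.
      + intros c Hc. apply H2. intros r [t [Ht ->]]. auto. }
  apply choice in Hinf. destruct Hinf as [q' Hq'].
  assert (Hle : forall x, q' x <= q x).
  { intros x. generalize (proj1 (Hq' x) 0 (Rle_refl 0)).
    replace (vadd x (rscal 0 a)) with x by vlin. lra. }
  exists q'. repeat split.
  - intros x y. enough (q' (vadd x y) - q' y <= q' x) by lra.
    apply (Hq' x). intros s Hs.
    enough (q' (vadd x y) - (q (vadd x (rscal s a)) - s * q a) <= q' y) by lra.
    apply (Hq' y). intros t Ht.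
    (* Parameters s for x and t for y combine into s + t for x + y. *)
    generalize (proj1 (Hq' (vadd x y)) (s + t) ltac:(lra)).
    generalize (proj1 Hq (vadd x (rscal s a)) (vadd y (rscal t a))).
    replace (vadd (vadd x (rscal s a)) (vadd y (rscal t a)))
      with (vadd (vadd x y) (rscal (s + t) a)) by vlin. lra.
  - intros r x Hr. enough (q' (rscal r x) / r <= q' x) as H.
    { apply (Rmult_le_compat_l r) in H; [|lra].
      replace (r * (q' (rscal r x) / r)) with (q' (rscal r x)) in H by (field; lra).
      exact H. }
    apply (Hq' x). intros t Ht.
    (* The expression for r x at parameter r t is r times the one for x at t. *)
    generalize (proj1 (Hq' (rscal r x)) (r * t) ltac:(nra)).
    replace (vadd (rscal r x) (rscal (r * t) a))
      with (rscal r (vadd x (rscal t a))) by vlin.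
    rewrite (sublinear_scal X q r _ Hq) by lra. intros H.
    apply (Rmult_le_reg_l r); [lra|].
    replace (r * (q' (rscal r x) / r)) with (q' (rscal r x)) by (field; lra). lra.
  - intros x. eapply Rle_trans; [apply Hle|apply Hq].
  - exact Hle.
  - intros x. generalize (proj1 (Hq' x) 1 ltac:(lra)).
    replace (vadd x (rscal 1 a)) with (vadd x a) by vlin. lra.
Qed.

(** Zorn's lemma for the reversed pointwise order; a chain is bounded by its pointwise infimum.
    Minimal sublinear functionals turn out to be linear, so Hahn-Banach needs no extension from
    subspaces. *)
Lemma sublinear_minimal (X : Banach) (q : X -> R) :
  sublinear X q ->
  exists q0, sublinear X q0 /\ (forall x, q0 x <= q x) /\
    forall q', sublinear X q' -> (forall x, q' x <= q0 x) -> forall x, q0 x <= q' x.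
Proof.
  intros Hq.
  set (Ty := {f : X -> R | sublinear X f /\ forall x, f x <= q x}).
  set (ge := fun f g : Ty => boolp.asbool (forall x, proj1_sig g x <= proj1_sig f x)).
  assert (geE : forall f g, is_true (ge f g) <-> forall x, proj1_sig g x <= proj1_sig f x).
  { intros f g. split; intros H.
    - exact (boolp.asboolW H).
    - exact (boolp.asboolT H). }
  set (t0 := exist _ q (conj Hq (fun x => Rle_refl (q x))) : Ty).
  destruct (classical_sets.ZL_preorder t0 (R := ge)) as [[q0 [H1 H2]] Hmax].
  - intros t. apply geE. intros; lra.
  - intros r s t Hrs Hst. rewrite geE in *. intros x.
    specialize (Hrs x). specialize (Hst x). lra.
  (* The empty chain has no infimum and is bounded by [t0] instead. *)
  - intros A HA. destruct (classic (exists f, A f)) as [[f0 Hf0]|HE];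
      [|exists t0; intros s Hs; destruct HE; eauto].
    assert (Hinf : forall x : X, exists m,
      (forall f, A f -> m <= proj1_sig f x) /\
      (forall c, (forall f, A f -> c <= proj1_sig f x) -> c <= m)).
    { intros x.
      destruct (inf_exists (fun r => exists f, A f /\ r = proj1_sig f x)
        (- vnorm x)) as [m [H1 H2]].
      - eauto.
      - intros r [f [_ ->]]. destruct f as [f [Hf Hf']]; simpl.
        generalize (sublinear_opp X f x Hf) (proj2 (proj2 Hf) (vopp x)).
        rewrite norm_opp. lra.
      - exists m. split.
        + intros f Hf. apply H1. eauto.
        + intros c Hc. apply H2. intros r [f [Hf ->]]. auto. }
    apply choice in Hinf. destruct Hinf as [p Hp].
    assert (Hle : forall x, p x <= q x).
    { intros x. eapply Rle_trans; [apply (proj1 (Hp x) f0 Hf0)|].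
      destruct f0 as [f [Hf Hf']]. apply Hf'. }
    assert (Hsub : sublinear X p).
    { repeat split.
      - intros x y. enough (p (vadd x y) - p y <= p x) by lra.
        apply (Hp x). intros f Hf.
        enough (p (vadd x y) - proj1_sig f x <= p y) by lra.
        apply (Hp y). intros g Hg.
        (* Of two members of the chain the pointwise smaller one can be used at both x and y; this
           is where totality enters. *)
        destruct (HA f g Hf Hg) as [HH|HH]; rewrite geE in HH.
        + generalize (HH x) (proj1 (Hp (vadd x y)) g Hg).
          generalize (proj1 (proj1 (proj2_sig g)) x y). lra.
        + generalize (HH y) (proj1 (Hp (vadd x y)) f Hf).
          generalize (proj1 (proj1 (proj2_sig f)) x y). lra.
      - intros r x Hr. enough (p (rscal r x) / r <= p x) as H.
        { apply (Rmult_le_compat_l r) in H; [|lra].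
          replace (r * (p (rscal r x) / r)) with (p (rscal r x)) in H by (field; lra).
          exact H. }
        apply (Hp x). intros f Hf. apply (Rmult_le_reg_l r); [lra|].
        replace (r * (p (rscal r x) / r)) with (p (rscal r x)) by (field; lra).
        eapply Rle_trans; [apply (proj1 (Hp _) f Hf)|].
        apply (proj1 (proj2_sig f)). exact Hr.
      - intros x. eapply Rle_trans; [apply Hle|apply Hq]. }
    exists (exist _ p (conj Hsub Hle)). intros s Hs. apply geE. intros x.
    apply (Hp x). exact Hs.
  - exists q0. split; [exact H1|]. split; [exact H2|]. intros q' Hq' Hle.
    assert (Hle' : forall x, q' x <= q x).
    { intros x. eapply Rle_trans; [apply Hle|apply H2]. }
    specialize (Hmax (exist _ q' (conj Hq' Hle'))). rewrite !geE in Hmax.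
    exact (Hmax Hle).
Qed.

(** Shifting the norm by e before minimising forces f(-e) <= |-e + e| - |e| = -|e|. *)
Lemma real_hahn_banach (X : Banach) (e : X) :
  exists f : X -> R,
    (forall x y, f (vadd x y) = f x + f y) /\
    (forall r x, f (rscal r x) = r * f x) /\
    (forall x, Rabs (f x) <= vnorm x) /\ vnorm e <= f e.
Proof.
  destruct (sublinear_shift X vnorm e (sublinear_norm X)) as [p [Hp [_ Hpe]]].
  destruct (sublinear_minimal X p Hp) as [f [Hf [Hfp Hmin]]].
  assert (Hadd : forall x y, f (vadd x y) = f x + f y).
  { intros x y. apply Rle_antisym; [apply Hf|].
    (* Minimality gives f <= f', and f' x <= f(x + y) - f y then yields the missing half of
       additivity. *)
    destruct (sublinear_shift X f y Hf) as [f' [H1 [H2 H3]]].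
    generalize (Hmin f' H1 H2 x) (H3 x). lra. }
  assert (Hopp : forall x, f (vopp x) = - f x).
  { intros x. generalize (Hadd x (vopp x)).
    rewrite add_opp, (sublinear_zero X f Hf). lra. }
  exists f. split; [exact Hadd|]. split; [|split].
  - intros r x. destruct (Rle_dec 0 r) as [Hr|Hr].
    + apply sublinear_scal; assumption.
    + replace (rscal r x) with (vopp (rscal (- r) x)) by vlin.
      rewrite Hopp, sublinear_scal by (assumption || lra). ring.
  - intros x. generalize (proj2 (proj2 Hf) x) (proj2 (proj2 Hf) (vopp x)).
    rewrite norm_opp, Hopp. intros H1 H2. apply Rabs_le. lra.
  - generalize (Hfp (vopp e)) (Hpe (vopp e)).
    rewrite Hopp, add_comm, add_opp, norm_zero. lra.
Qed.

(** * Complex modulus and complex functionals *)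

Lemma Cabs_nonneg (a : Cplx) : 0 <= Cabs a.
Proof. apply sqrt_pos. Qed.

Lemma Cabs_mul (a b : Cplx) : Cabs (Cmul a b) = Cabs a * Cabs b.
Proof.
  unfold Cabs. rewrite <- sqrt_mult by nra. f_equal. simpl. ring.
Qed.

Lemma Cabs_add (a b : Cplx) : Cabs (Cadd a b) <= Cabs a + Cabs b.
Proof.
  assert (Ha := Cabs_nonneg a). assert (Hb := Cabs_nonneg b).
  assert (Ea : Cabs a * Cabs a = Re a * Re a + Im a * Im a)
    by (apply sqrt_sqrt; nra).
  assert (Eb : Cabs b * Cabs b = Re b * Re b + Im b * Im b)
    by (apply sqrt_sqrt; nra).
  assert (H : Re a * Re b + Im a * Im b <= Cabs a * Cabs b).
  { apply Rsqr_incr_0_var; [|nra]. unfold Rsqr.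
    replace (Cabs a * Cabs b * (Cabs a * Cabs b))
      with ((Cabs a * Cabs a) * (Cabs b * Cabs b)) by ring.
    (* Lagrange's identity: the two squares differ by (Re a Im b - Im a Re b)^2. *)
    rewrite Ea, Eb. generalize (Rle_0_sqr (Re a * Im b - Im a * Re b)).
    unfold Rsqr. lra. }
  apply Rsqr_incr_0_var; [|lra].
  assert (Eab : Cabs (Cadd a b) * Cabs (Cadd a b)
    = Re (Cadd a b) * Re (Cadd a b) + Im (Cadd a b) * Im (Cadd a b))
    by (apply sqrt_sqrt; nra).
  unfold Rsqr. rewrite Eab. simpl. nra.
Qed.

Lemma Cabs_le_sum (a : Cplx) : Cabs a <= Rabs (Re a) + Rabs (Im a).
Proof.
  replace a with (Cadd (mkC (Re a) 0) (mkC 0 (Im a))) at 1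
    by (apply Cplx_eq; simpl; ring).
  eapply Rle_trans; [apply Cabs_add|].
  replace (mkC 0 (Im a)) with (Cmul (mkC 0 1) (mkC (Im a) 0))
    by (apply Cplx_eq; simpl; ring).
  rewrite Cabs_mul, !Cabs_real. unfold Cabs; simpl.
  replace (0 * 0 + 1 * 1) with 1 by ring. rewrite sqrt_1. lra.
Qed.

Lemma Rabs_Re_le (a : Cplx) : Rabs (Re a) <= Cabs a.
Proof.
  rewrite <- sqrt_Rsqr_abs. apply sqrt_le_1_alt. unfold Rsqr. nra.
Qed.

Lemma Rabs_Im_le (a : Cplx) : Rabs (Im a) <= Cabs a.
Proof.
  rewrite <- sqrt_Rsqr_abs. apply sqrt_le_1_alt. unfold Rsqr. nra.
Qed.

(** The scalar field is not packaged as a [Banach] space, so functionals get their own predicate. *)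
Definition is_functional (X : Banach) (f : X -> Cplx) : Prop :=
  (forall x y, f (vadd x y) = Cadd (f x) (f y)) /\
  (forall (a : Cplx) x, f (vscal a x) = Cmul a (f x)) /\
  exists M, forall x, Cabs (f x) <= M * vnorm x.

Lemma blin_rank_one (X Y : Banach) (f : X -> Cplx) (y : Y) :
  is_functional X f -> is_bounded_linear X Y (fun x => vscal (f x) y).
Proof.
  intros [fa [fs [M HM]]]. repeat split.
  - intros. rewrite fa. vlin.
  - intros. rewrite fs. vlin.
  - exists (M * vnorm y). intros x. rewrite norm_scal.
    generalize (HM x) (norm_nonneg Y y). nra.
Qed.

(** The real functional u is complexified to g x = u x - i u(ix), with |g x| <= 2 |x|, and then
    divided by w = g e. Here w is non-zero because its real part u e is at least |e|, and [c] is
    1/w. *)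
Lemma hahn_banach (X : Banach) (e : X) :
  e <> vzero -> exists f, is_functional X f /\ f e = C1.
Proof.
  intros He. apply norm_pos in He.
  destruct (real_hahn_banach X e) as [u [ua [us [ub ue]]]].
  set (i := mkC 0 1).
  set (g := fun x : X => mkC (u x) (- u (vscal i x))).
  set (w := g e).
  assert (Hw : 0 < Re w * Re w + Im w * Im w).
  { assert (0 < Re w) by (simpl; lra). nra. }
  set (c := mkC (Re w / (Re w * Re w + Im w * Im w))
                (- Im w / (Re w * Re w + Im w * Im w))).
  exists (fun x => Cmul c (g x)). split; [split; [|split]|].
  - intros x y. unfold g. rewrite scal_addr, !ua. apply Cplx_eq; simpl; ring.
  - intros a x. unfold g.
    replace (vscal a x) with (vadd (rscal (Re a) x) (rscal (Im a) (vscal i x))) by vlin.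
    replace (vscal i (vadd (rscal (Re a) x) (rscal (Im a) (vscal i x))))
      with (vadd (rscal (Re a) (vscal i x)) (rscal (- Im a) x)) by vlin.
    rewrite !ua, !us. apply Cplx_eq; simpl; ring.
  - exists (Cabs c * 2). intros x. rewrite Cabs_mul, Rmult_assoc.
    apply Rmult_le_compat_l; [apply Cabs_nonneg|].
    eapply Rle_trans; [apply Cabs_le_sum|]. simpl. rewrite Rabs_Ropp.
    generalize (ub x) (ub (vscal i x)). rewrite norm_scal.
    replace (Cabs i) with 1; [lra|]. unfold Cabs; simpl.
    replace (0 * 0 + 1 * 1) with 1 by ring. symmetry; apply sqrt_1.
  - fold w. apply Cplx_eq; unfold c; simpl Re; simpl Im; field; exact (Rgt_not_eq _ _ Hw).
Qed.

(** * Riesz theory of compact operators *)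

(** Bolzano-Weierstrass provides only a cluster value l: past any index some term is close to l.
    Choosing such terms recursively gives the subsequence. *)
Lemma real_bounded_subsequence (u : nat -> R) (M : R) :
  (forall n, Rabs (u n) <= M) ->
  exists phi l, extraction phi /\
    forall eps, 0 < eps -> exists N, forall n, (N <= n)%nat -> Rabs (u (phi n) - l) < eps.
Proof.
  intros HM.
  destruct (Bolzano_Weierstrass u (fun c => - M <= c <= M)) as [l Hl].
  - apply compact_P3.
  - intros n. generalize (HM n) (Rle_abs (u n)) (Rle_abs (- u n)).
    rewrite Rabs_Ropp. lra.
  - assert (Hg : forall p : nat * nat, exists q,
      (snd p <= q)%nat /\ Rabs (u q - l) < / (INR (fst p) + 1)).
    { intros [n N]; simpl.
      assert (Hn : 0 < / (INR n + 1)).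
      { apply Rinv_0_lt_compat. generalize (pos_INR n). lra. }
      destruct (Hl (fun x => Rabs (x - l) < / (INR n + 1)) N) as [q Hq].
      - exists (mkposreal _ Hn). intros x Hx. exact Hx.
      - exists q. exact Hq. }
    apply choice in Hg. destruct Hg as [g Hg].
    (* Restarting the search at [S (phi k)] makes [phi] strictly increasing. *)
    set (phi := fix phi n :=
      match n with O => g (0, 0)%nat | S k => g (S k, S (phi k)) end).
    assert (Hphi : forall n, Rabs (u (phi n) - l) < / (INR n + 1)).
    { intros [|n]; apply Hg. }
    exists phi, l. split.
    + intros n. exact (proj1 (Hg (S n, S (phi n)))).
    + intros eps He. destruct (archimed_cor1 eps He) as [N [HN HN0]].
      exists N. intros n Hn. eapply Rlt_trans; [apply Hphi|].
      eapply Rle_lt_trans; [|exact HN]. apply Rinv_le_contravar.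
      * apply lt_0_INR; assumption.
      * apply le_INR in Hn. lra.
Qed.

(** Three nested extractions: one for K, one for the real part and one for the imaginary part of the
    bounded scalars f(u n). *)
Lemma compact_add_rank_one (X Y : Banach) (K : X -> Y) (f : X -> Cplx) (y : Y) :
  is_compact_op X Y K -> is_functional X f ->
  is_compact_op X Y (fun x => vadd (K x) (vscal (f x) y)).
Proof.
  intros [HK HKc] Hf. split.
  { apply blin_add; [exact HK|]. apply blin_rank_one; exact Hf. }
  intros u Hu. destruct (HKc u Hu) as [p [l [Hp Hl]]].
  assert (exists M, forall n, Cabs (f (u n)) <= M) as [M HM].
  { destruct Hf as [_ [_ [M HM]]]. exists (Rmax M 0). intros n.
    eapply Rle_trans; [apply HM|].
    generalize (Hu n) (norm_nonneg X (u n)) (Rmax_l M 0) (Rmax_r M 0). nra. }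
  destruct (real_bounded_subsequence (fun n => Re (f (u (p n)))) M)
    as [q [a [Hq Ha]]].
  { intros n. eapply Rle_trans; [apply Rabs_Re_le|apply HM]. }
  destruct (real_bounded_subsequence (fun n => Im (f (u (p (q n))))) M)
    as [r [b [Hr Hb]]].
  { intros n. eapply Rle_trans; [apply Rabs_Im_le|apply HM]. }
  exists (fun n => p (q (r n))), (vadd l (vscal (mkC a b) y)). split.
  { exact (extraction_comp p _ Hp (extraction_comp q r Hq Hr)). }
  apply (converges_add Y (fun n => K (u (p (q (r n)))))
    (fun n => vscal (f (u (p (q (r n))))) y)).
  { exact (converges_sub Y _ l _ (extraction_comp q r Hq Hr) Hl). }
  intros eps He.
  assert (Hy : 0 < vnorm y + 1) by (generalize (norm_nonneg Y y); lra).
  (* The 2 shares the error between real and imaginary part; the + 1 covers y = 0. *)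
  assert (He' : 0 < eps / (2 * (vnorm y + 1))) by (apply Rdiv_lt_0_compat; lra).
  destruct (Ha _ He') as [N HN]. destruct (Hb _ He') as [N' HN'].
  exists (N + N')%nat. intros n Hn.
  specialize (HN (r n)). specialize (HN' n ltac:(lia)).
  assert (Hrn := extraction_ge r Hr n). specialize (HN ltac:(lia)).
  set (c := f (u (p (q (r n))))) in *.
  replace (vsub (vscal c y) (vscal (mkC a b) y))
    with (vscal (mkC (Re c - a) (Im c - b)) y) by vlin.
  rewrite norm_scal.
  assert (Hc : Cabs (mkC (Re c - a) (Im c - b)) < eps / (vnorm y + 1)).
  { eapply Rle_lt_trans; [apply Cabs_le_sum|]. simpl.
    replace (eps / (vnorm y + 1))
      with (eps / (2 * (vnorm y + 1)) + eps / (2 * (vnorm y + 1))) by (field; lra).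
    lra. }
  apply Rle_lt_trans with (Cabs (mkC (Re c - a) (Im c - b)) * (vnorm y + 1)).
  { apply Rmult_le_compat_l; [apply Cabs_nonneg|lra]. }
  apply (Rmult_lt_compat_r (vnorm y + 1)) in Hc; [|lra].
  replace (eps / (vnorm y + 1) * (vnorm y + 1)) with eps in Hc by (field; lra).
  exact Hc.
Qed.

(** Compactness is stated on the unit ball, so f(u n) is first divided by a bound M of f and the
    limit is multiplied by M. *)
Lemma compact_comp (X Y Z : Banach) (f : X -> Y) (K : Y -> Z) :
  is_bounded_linear X Y f -> is_compact_op Y Z K ->
  is_compact_op X Z (fun x => K (f x)).
Proof.
  intros Hf [HK HKc]. split; [eapply blin_comp; eassumption|].
  intros u Hu. destruct (blin_bound X Y f Hf) as [M [HM0 HM]].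
  destruct (HKc (fun n => rscal (/ M) (f (u n)))) as [p [l [Hp Hl]]].
  - intros n. rewrite norm_scal, Cabs_real, Rabs_right
      by (apply Rle_ge, Rlt_le, Rinv_0_lt_compat; lra).
    apply (Rmult_le_reg_l M); [lra|].
    rewrite <- Rmult_assoc, Rinv_r, Rmult_1_l by lra.
    generalize (HM (u n)) (Hu n). nra.
  - exists p, (rscal M l). split; [exact Hp|].
    apply (converges_ext Z (fun n => rscal M (K (rscal (/ M) (f (u (p n))))))).
    + intros n. rewrite (proj1 (proj2 HK)). vlin_coefs; field; lra.
    + intros eps He.
      destruct (Hl (eps / M)) as [N HN]; [apply Rdiv_lt_0_compat; lra|].
      exists N. intros n Hn. specialize (HN n Hn).
      set (z := K (rscal (/ M) (f (u (p n))))) in *.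
      replace (vsub (rscal M z) (rscal M l)) with (rscal M (vsub z l)) by vlin.
      rewrite norm_scal, Cabs_real, Rabs_right by lra.
      apply (Rmult_lt_compat_l M) in HN; [|lra].
      replace (M * (eps / M)) with eps in HN by (field; lra). exact HN.
Qed.

Lemma compact_not_separated (X Y : Banach) (K : X -> Y) (u : nat -> X) :
  is_compact_op X Y K -> (forall n, vnorm (u n) <= 1) ->
  (forall k m, (k < m)%nat -> 1 / 2 <= vnorm (vsub (K (u m)) (K (u k)))) -> False.
Proof.
  intros [_ HK] Hu Hs. destruct (HK u Hu) as [p [l [Hp Hl]]].
  destruct (converges_cauchy Y _ l Hl (1 / 2)) as [N HN]; [lra|].
  specialize (HN (S N) N ltac:(lia) ltac:(lia)). specialize (Hs _ _ (Hp N)). lra.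
Qed.

(** * Riesz lemma and chains of closed subspaces *)

Definition closed_subspace (X : Banach) (V : X -> Prop) : Prop :=
  V vzero /\ (forall x y, V x -> V y -> V (vadd x y)) /\
  (forall a x, V x -> V (vscal a x)) /\
  (forall u l, (forall n, V (u n)) -> converges X u l -> V l).

Lemma closed_subspace_sub (X : Banach) (V : X -> Prop) (x y : X) :
  closed_subspace X V -> V x -> V y -> V (vsub x y).
Proof.
  intros [_ [Va [Vs _]]] Hx Hy. rewrite vopp_scal. auto.
Qed.

Lemma riesz_lemma (X : Banach) (V W : X -> Prop) (w : X) :
  closed_subspace X V -> closed_subspace X W -> (forall x, V x -> W x) ->
  W w -> ~ V w ->
  exists v, W v /\ vnorm v <= 1 /\ forall z, V z -> 1 / 2 <= vnorm (vsub v z).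
Proof.
  intros HV HW HVW Hw Hnw.
  destruct (inf_exists (fun r => exists z, V z /\ r = vnorm (vsub w z)) 0)
    as [d [Hd Hd']].
  { exists (vnorm (vsub w vzero)), vzero. split; [apply HV|reflexivity]. }
  { intros r [z [_ ->]]. apply norm_nonneg. }
  assert (Happrox : forall eps, 0 < eps -> exists z, V z /\ vnorm (vsub w z) < d + eps).
  { intros eps He. apply NNPP. intros Hn.
    assert (d + eps <= d); [|lra]. apply Hd'. intros r [z [Hz ->]].
    apply Rnot_lt_le. intros Hlt. apply Hn. eauto. }
  assert (Hd0 : 0 < d).
  { assert (0 <= d) as [Hlt|E].
    { apply Hd'. intros r [z [_ ->]]. apply norm_nonneg. }
    - exact Hlt.
    (* At distance 0 a sequence in V would converge to w, and closedness would put w in V. *)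
    - destruct Hnw. subst d.
      destruct (choice (fun n z => V z /\ vnorm (vsub w z) < / (INR n + 1)))
        as [u Hu].
      { intros n. destruct (Happrox (/ (INR n + 1))) as [z [Hz Hlt]].
        - apply Rinv_0_lt_compat. generalize (pos_INR n). lra.
        - exists z. split; [exact Hz|]. lra. }
      apply (proj2 (proj2 (proj2 HV)) u); [intros n; apply Hu|].
      intros eps He. destruct (archimed_cor1 eps He) as [N [HN HN0]].
      exists N. intros n Hn. rewrite norm_sub_sym.
      eapply Rlt_trans; [apply Hu|]. eapply Rle_lt_trans; [|exact HN].
      apply Rinv_le_contravar.
      + apply lt_0_INR; assumption.
      + apply le_INR in Hn. lra. }
  (* Taking eps = d gives s < 2 d, so after division by s the distance d / s to V exceeds 1/2. *)
  destruct (Happrox d Hd0) as [v0 [Hv0 Hlt]].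
  set (s := vnorm (vsub w v0)) in *.
  assert (Hs : d <= s) by (apply Hd; unfold s; eauto).
  assert (Hsi : 0 < / s) by (apply Rinv_0_lt_compat; lra).
  exists (rscal (/ s) (vsub w v0)). split; [|split].
  - apply HW. apply closed_subspace_sub; auto.
  - rewrite norm_scal, Cabs_real, Rabs_right by lra. fold s.
    rewrite Rinv_l by lra. lra.
  - intros z Hz.
    replace (vsub (rscal (/ s) (vsub w v0)) z)
      with (rscal (/ s) (vsub w (vadd v0 (rscal s z)))) by (vlin_coefs; field; lra).
    rewrite norm_scal, Cabs_real, Rabs_right by lra.
    assert (Hz' : d <= vnorm (vsub w (vadd v0 (rscal s z)))).
    { apply Hd. eexists; split; [|reflexivity]. apply HV; [exact Hv0|].
      apply HV; exact Hz. }
    apply (Rmult_le_reg_l s); [lra|]. rewrite <- Rmult_assoc, Rinv_r by lra. lra.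
Qed.

(** Let L = 1 - K and let v k in V k be at distance at least 1/2 from V (k+1). For k < m, K(v k) -
    K(v m) = v k - (L(v k) + v m - L(v m)) with the bracket in V (k+1), so the images under K stay
    1/2 apart. *)
Lemma compact_no_descending_chain (X : Banach) (K : X -> X) (V : nat -> X -> Prop) :
  is_compact_op X X K ->
  (forall k, closed_subspace X (V k)) ->
  (forall k x, V (S k) x -> V k x) ->
  (forall k x, V k x -> V (S k) (vsub x (K x))) ->
  (forall k, exists w, V k w /\ ~ V (S k) w) -> False.
Proof.
  intros HK HV Hmono HL Hstrict.
  destruct (choice (fun k v => V k v /\ vnorm v <= 1 /\
    forall z, V (S k) z -> 1 / 2 <= vnorm (vsub v z))) as [v Hv].
  { intros k. destruct (Hstrict k) as [w [H1 H2]].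
    apply (riesz_lemma X (V (S k)) (V k) w); auto. }
  assert (Hle : forall k m x, (k <= m)%nat -> V m x -> V k x).
  { intros k m x L. induction L; auto. }
  apply (compact_not_separated X X K v HK); [apply Hv|].
  intros k m Hkm. rewrite norm_sub_sym.
  replace (vsub (K (v k)) (K (v m)))
    with (vsub (v k) (vadd (vsub (v k) (K (v k))) (vsub (v m) (vsub (v m) (K (v m))))))
    by vlin.
  apply Hv. apply HV; [apply HL, Hv|].
  apply closed_subspace_sub; [apply HV|apply (Hle _ m)|apply (Hle _ (S m))].
  - lia.
  - apply Hv.
  - lia.
  - apply HL, Hv.
Qed.

(** The same identity with k and m exchanged: v m is now far from V m, which contains L(v m), v k
    and L(v k) when k < m. *)
Lemma compact_no_ascending_chain (X : Banach) (K : X -> X) (V : nat -> X -> Prop) :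
  is_compact_op X X K ->
  (forall k, closed_subspace X (V k)) ->
  (forall k x, V k x -> V (S k) x) ->
  (forall k x, V (S k) x -> V k (vsub x (K x))) ->
  (forall k, exists w, V (S k) w /\ ~ V k w) -> False.
Proof.
  intros HK HV Hmono HL Hstrict.
  destruct (choice (fun k v => V (S k) v /\ vnorm v <= 1 /\
    forall z, V k z -> 1 / 2 <= vnorm (vsub v z))) as [v Hv].
  { intros k. destruct (Hstrict k) as [w [H1 H2]].
    apply (riesz_lemma X (V k) (V (S k)) w); auto. }
  assert (Hle : forall k m x, (k <= m)%nat -> V k x -> V m x).
  { intros k m x L. induction L; auto. }
  apply (compact_not_separated X X K v HK); [apply Hv|].
  intros k m Hkm.
  replace (vsub (K (v m)) (K (v k)))
    with (vsub (v m) (vadd (vsub (v m) (K (v m))) (vsub (v k) (vsub (v k) (K (v k))))))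
    by vlin.
  apply Hv. apply HV; [apply HL, Hv|].
  apply closed_subspace_sub; [apply HV|apply (Hle (S k))|apply (Hle k)].
  - lia.
  - apply Hv.
  - lia.
  - apply HL, Hv.
Qed.

Lemma closed_subspace_ker (X Y : Banach) (f : X -> Y) :
  is_bounded_linear X Y f -> closed_subspace X (fun x => f x = vzero).
Proof.
  intros Hf. repeat split.
  - apply (blin_zero X Y f Hf).
  - intros x y Hx Hy. rewrite (proj1 Hf), Hx, Hy. apply add_zero.
  - intros a x Hx. rewrite (proj1 (proj2 Hf)), Hx. apply vscal_zero.
  - intros u l Hu Hl.
    apply (converges_unique Y (fun n => f (u n))).
    + apply (converges_blin X Y f u l Hf Hl).
    + apply (converges_ext Y (fun _ => vzero)); [auto|]. apply converges_const.
Qed.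

(** The lower bound makes preimages of a convergent sequence Cauchy, and completeness of X supplies
    their limit. *)
Lemma closed_subspace_range (X Y : Banach) (f : X -> Y) :
  is_bounded_linear X Y f -> bounded_below X Y f ->
  closed_subspace Y (fun y => exists x, f x = y).
Proof.
  intros Hf [c [Hc Hb]]. repeat split.
  - exists vzero. apply (blin_zero X Y f Hf).
  - intros x y [x' <-] [y' <-]. exists (vadd x' y'). apply Hf.
  - intros a x [x' <-]. exists (vscal a x'). apply Hf.
  - intros u l Hu Hl. apply choice in Hu. destruct Hu as [v Hv].
    destruct (complete X v) as [x Hx].
    + intros eps He.
      destruct (converges_cauchy Y u l Hl (c * eps)) as [N HN]; [nra|].
      exists N. intros n m Hn Hm. specialize (HN n m Hn Hm).
      rewrite <- !Hv, <- (blin_sub X Y f _ _ Hf) in HN.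
      specialize (Hb (vsub (v n) (v m))). apply (Rmult_lt_reg_l c); lra.
    + exists x. apply (converges_unique Y u); [|exact Hl].
      apply (converges_ext Y (fun n => f (v n))); [exact Hv|].
      apply (converges_blin X Y f v x Hf Hx).
Qed.

Lemma blin_id_minus (X : Banach) (K : X -> X) :
  is_bounded_linear X X K -> is_bounded_linear X X (fun x => vsub x (K x)).
Proof.
  intros HK. apply blin_add; [apply blin_id|]. apply blin_opp_op; exact HK.
Qed.

Lemma blin_iter (X : Banach) (L : X -> X) (n : nat) :
  is_bounded_linear X X L -> is_bounded_linear X X (fun x => Nat.iter n L x).
Proof.
  intros HL. induction n as [|n IH]; simpl; [apply blin_id|].
  apply (blin_comp X X X _ L IH HL).
Qed.

Lemma bounded_below_iter (X : Banach) (L : X -> X) (n : nat) :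
  bounded_below X X L -> bounded_below X X (fun x => Nat.iter n L x).
Proof.
  intros HL. induction n as [|n IH]; simpl.
  - exists 1. split; [lra|]. intros; lra.
  - apply (bounded_below_comp X X X _ L IH HL).
Qed.

(** * Fredholm alternative for 1 - K *)

(** Otherwise there are unit vectors u n with u n - K(u n) tending to 0. Along a subsequence K(u n)
    converges to some l, hence so does u n, and l is a vector of norm at least 1 in the kernel. *)
Lemma compact_injective_bounded_below (X : Banach) (K : X -> X) :
  is_compact_op X X K ->
  (forall x, vsub x (K x) = vzero -> x = vzero) ->
  bounded_below X X (fun x => vsub x (K x)).
Proof.
  intros [HK HKc] Hinj. apply NNPP. intros Hn.
  assert (HL := blin_id_minus X K HK).
  assert (Hu : forall n : nat, exists x : X,
    vnorm x = 1 /\ vnorm (vsub x (K x)) < / (INR n + 1)).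
  { intros n. apply NNPP. intros Hx. apply Hn. exists (/ (INR n + 1)).
    split; [apply Rinv_0_lt_compat; generalize (pos_INR n); lra|].
    intros x. destruct (classic (x = vzero)) as [->|Hx0].
    - rewrite norm_zero, Rmult_0_r. apply norm_nonneg.
    - apply Rnot_lt_le. intros Hlt. apply Hx. apply norm_pos in Hx0.
      assert (Hi : 0 < / vnorm x) by (apply Rinv_0_lt_compat; lra).
      exists (rscal (/ vnorm x) x).
      rewrite norm_scal, Cabs_real, Rabs_right by lra.
      split; [apply Rinv_l; lra|].
      rewrite (proj1 (proj2 HK)).
      replace (vsub (rscal (/ vnorm x) x) (rscal (/ vnorm x) (K x)))
        with (rscal (/ vnorm x) (vsub x (K x))) by vlin.
      rewrite norm_scal, Cabs_real, Rabs_right by lra.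
      apply (Rmult_lt_reg_l (vnorm x)); [lra|].
      rewrite <- Rmult_assoc, Rinv_r by lra. lra. }
  apply choice in Hu. destruct Hu as [u Hu].
  destruct (HKc u) as [p [l [Hp Hl]]].
  { intros n. rewrite (proj1 (Hu n)). lra. }
  assert (Hdiff : converges X (fun n => vsub (u (p n)) (K (u (p n)))) vzero).
  { apply (converges_sub X (fun n => vsub (u n) (K (u n))) vzero p Hp).
    intros eps He. destruct (archimed_cor1 eps He) as [N [HN HN0]].
    exists N. intros n Hn'.
    replace (vsub (vsub (u n) (K (u n))) vzero) with (vsub (u n) (K (u n))) by vlin.
    eapply Rlt_trans; [apply Hu|]. eapply Rle_lt_trans; [|exact HN].
    apply Rinv_le_contravar; [apply lt_0_INR; assumption|].
    apply le_INR in Hn'. lra. }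
  assert (Hul : converges X (fun n => u (p n)) l).
  { replace l with (vadd vzero l) by vlin.
    apply (converges_ext X
      (fun n => vadd (vsub (u (p n)) (K (u (p n)))) (K (u (p n))))).
    - intros n. vlin.
    - apply (converges_add X (fun n => vsub (u (p n)) (K (u (p n))))); assumption. }
  assert (H1 : 1 <= vnorm l).
  { apply (converges_norm_le X _ l 1 Hul). intros n. rewrite (proj1 (Hu _)). lra. }
  rewrite (Hinj l), norm_zero in H1; [lra|].
  apply (converges_unique X (fun n => vsub (u (p n)) (K (u (p n))))); [|exact Hdiff].
  apply (converges_blin X X (fun x => vsub x (K x)) _ l HL Hul).
Qed.

(** If y is missed by L = 1 - K, injectivity of L^k keeps L^k y out of the range of L^(k+1), so the
    closed ranges descend strictly. *)
Lemma compact_injective_surjective (X : Banach) (K : X -> X) :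
  is_compact_op X X K ->
  (forall x, vsub x (K x) = vzero -> x = vzero) ->
  forall y, exists x, vsub x (K x) = y.
Proof.
  intros HK Hinj y. apply NNPP. intros Hy.
  set (L := fun x : X => vsub x (K x)).
  assert (HL : is_bounded_linear X X L) by (apply blin_id_minus, HK).
  assert (Hb : bounded_below X X L)
    by (apply compact_injective_bounded_below; assumption).
  apply (compact_no_descending_chain X K (fun n z => exists x, Nat.iter n L x = z) HK).
  - intros k. apply (closed_subspace_range X X (fun x => Nat.iter k L x)).
    + apply blin_iter; exact HL.
    + apply bounded_below_iter; exact Hb.
  - intros k z [x <-]. exists (L x). symmetry; apply Nat.iter_succ_r.
  - intros k z [x <-]. exists x. reflexivity.
  - intros k. exists (Nat.iter k L y). split; [exists y; reflexivity|].
    intros [x Hx]. apply Hy. exists x. rewrite Nat.iter_succ_r in Hx.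
    apply (bounded_below_inj X X (fun x => Nat.iter k L x)) in Hx; [exact Hx| |].
    + apply blin_iter; exact HL.
    + apply bounded_below_iter; exact Hb.
Qed.

(** If L e = 0 with e non-zero, surjectivity gives w with L^k w = e. This w lies in ker L^(k+1) but
    not in ker L^k, so the kernels ascend strictly. *)
Lemma compact_surjective_injective (X : Banach) (K : X -> X) :
  is_compact_op X X K ->
  (forall y, exists x, vsub x (K x) = y) ->
  forall x, vsub x (K x) = vzero -> x = vzero.
Proof.
  intros HK Hsurj e He. apply NNPP. intros Hne.
  set (L := fun x : X => vsub x (K x)).
  assert (HL : is_bounded_linear X X L) by (apply blin_id_minus, HK).
  apply (compact_no_ascending_chain X K (fun n x => Nat.iter n L x = vzero) HK).
  - intros k. apply (closed_subspace_ker X X (fun x => Nat.iter k L x)).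
    apply blin_iter; exact HL.
  - intros k x Hx. simpl. rewrite Hx. apply (blin_zero X X L HL).
  - intros k x Hx. rewrite Nat.iter_succ_r in Hx. exact Hx.
  - intros k. assert (exists w, Nat.iter k L w = e) as [w Hw].
    { clear He Hne. revert e. induction k as [|k IH]; intros e; [exists e; reflexivity|].
      destruct (Hsurj e) as [x Hx]. destruct (IH x) as [w Hw].
      exists w. simpl. rewrite Hw. exact Hx. }
    exists w. simpl. rewrite Hw. split; [exact He|exact Hne].
Qed.

(** The inverse is bounded by the lower bound on 1 - K, without the open mapping theorem. *)
Lemma compact_injective_inverse (X : Banach) (K : X -> X) :
  is_compact_op X X K ->
  (forall x, vsub x (K x) = vzero -> x = vzero) ->
  exists B, is_bounded_linear X X B /\ forall x, B (vsub x (K x)) = x.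
Proof.
  intros HK Hinj.
  destruct (choice _ (compact_injective_surjective X K HK Hinj)) as [B HB].
  set (L := fun x : X => vsub x (K x)).
  assert (HL : is_bounded_linear X X L) by (apply blin_id_minus, HK).
  assert (Hb : bounded_below X X L)
    by (apply compact_injective_bounded_below; assumption).
  change (forall x, L (B x) = x) in HB.
  assert (Hi := bounded_below_inj X X L HL Hb).
  exists B. split; [split; [|split]|].
  - intros x y. apply Hi. rewrite (proj1 HL), !HB. reflexivity.
  - intros a x. apply Hi. rewrite (proj1 (proj2 HL)), !HB. reflexivity.
  - destruct Hb as [c [Hc Hb]]. exists (/ c). intros x. specialize (Hb (B x)).
    rewrite HB in Hb. apply (Rmult_le_reg_l c); [lra|].
    rewrite <- Rmult_assoc, Rinv_r by lra. lra.
  - intros x. apply Hi. apply HB.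
Qed.

(** * Finite-rank perturbations *)

(** Adding rank-one terms one at a time matches the correction step and gives the induction for
    compactness and ideal membership. The index is the function itself, hence the appeals to
    function extensionality. *)
Inductive finite_rank (X Y : Banach) : (X -> Y) -> Prop :=
  | finite_rank_zero : finite_rank X Y (fun _ => vzero)
  | finite_rank_add W f y :
      finite_rank X Y W -> is_functional X f ->
      finite_rank X Y (fun x => vadd (W x) (vscal (f x) y)).

Lemma compact_add_finite_rank (X Y : Banach) (K W : X -> Y) :
  is_compact_op X Y K -> finite_rank X Y W ->
  is_compact_op X Y (fun x => vadd (K x) (W x)).
Proof.
  intros HK HW. induction HW as [|W f y HW IH Hf].
  - replace (fun x => vadd (K x) vzero) with K; [exact HK|].
    apply boolp.funext. intros x. symmetry; apply add_zero.
  - replace (fun x => vadd (K x) (vadd (W x) (vscal (f x) y)))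
      with (fun x => vadd (vadd (K x) (W x)) (vscal (f x) y)).
    + apply (compact_add_rank_one X Y (fun x => vadd (K x) (W x))); assumption.
    + apply boolp.funext. intros x. symmetry; apply add_assoc.
Qed.

(** Let L = 1 - K - W. Having a kernel vector e, L is not surjective, so some y lies outside its
    range. Take f with f e = 1 and W' = W + f(.) y. A new kernel vector x satisfies L x = f(x) y,
    which forces f x = 0 and L x = 0, while e is sent to -y, which is non-zero. *)
Lemma finite_rank_correction (X : Banach) (K W : X -> X) :
  is_compact_op X X K -> finite_rank X X W ->
  (exists x, vsub x (vadd (K x) (W x)) = vzero /\ x <> vzero) ->
  exists W', finite_rank X X W' /\
    (forall x, vsub x (vadd (K x) (W' x)) = vzero ->
       vsub x (vadd (K x) (W x)) = vzero) /\
    exists x, vsub x (vadd (K x) (W x)) = vzero /\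
      vsub x (vadd (K x) (W' x)) <> vzero.
Proof.
  intros HK HW [e [He Hne]].
  assert (HKW := compact_add_finite_rank X X K W HK HW).
  assert (exists y, ~ exists x, vsub x (vadd (K x) (W x)) = y) as [y Hy].
  { apply not_all_ex_not. intros Hs. apply Hne.
    apply (compact_surjective_injective X _ HKW Hs e He). }
  assert (HL := blin_id_minus X _ (proj1 HKW)).
  destruct (hahn_banach X e Hne) as [f [Hf Hfe]].
  exists (fun x => vadd (W x) (vscal (f x) y)). split; [|split].
  - apply finite_rank_add; assumption.
  - intros x Hx.
    assert (E : vsub x (vadd (K x) (W x)) = vscal (f x) y).
    { apply sub_eq_zero. rewrite <- Hx. vlin. }
    destruct (classic (f x = C0)) as [H0|H0].
    { rewrite E, H0. apply vscal_C0. }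
    destruct Hy.
    assert (Hm : 0 < Re (f x) * Re (f x) + Im (f x) * Im (f x)).
    { destruct (Req_dec (Re (f x)) 0) as [E1|E1]; [|nra].
      destruct (Req_dec (Im (f x)) 0) as [E2|E2]; [|nra].
      destruct H0. apply Cplx_eq; assumption. }
    set (m := Re (f x) * Re (f x) + Im (f x) * Im (f x)) in *.
    (* This vector is x divided by f x; its image under L would be y. *)
    exists (vscal (mkC (Re (f x) / m) (- Im (f x) / m)) x).
    rewrite (proj1 (proj2 HL)). cbv beta. rewrite E, scal_assoc.
    rewrite <- (scal_one X y) at 2. f_equal.
    apply Cplx_eq; simpl; field_simplify; try lra; unfold m; field; fold m; lra.
  - exists e. split; [exact He|]. intros H. apply Hy. exists vzero.
    rewrite (blin_zero X X _ HL). rewrite Hfe, scal_one in H.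
    assert (E : vsub (vsub e (vadd (K e) (W e))) y = vzero) by (rewrite <- H; vlin).
    rewrite He in E. apply sub_eq_zero in E. exact E.
Qed.

(* Each correction shrinks the kernel strictly, so an endless supply of them
   would give a descending chain of subspaces of [ker (1 - K)]. *)
Lemma compact_finite_rank_left_inverse (X : Banach) (K : X -> X) :
  is_compact_op X X K ->
  exists W B, finite_rank X X W /\ is_bounded_linear X X B /\
    forall x, B (vsub x (vadd (K x) (W x))) = x.
Proof.
  intros HK. apply NNPP. intros Hn.
  set (Ty := {W : X -> X | finite_rank X X W}).
  set (ker := fun (W : Ty) (x : X) => vsub x (vadd (K x) (proj1_sig W x)) = vzero).
  assert (Hstep : forall W : Ty, exists W' : Ty,
    (forall x, ker W' x -> ker W x) /\ exists x, ker W x /\ ~ ker W' x).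
  { intros [W HW].
    destruct (finite_rank_correction X K W HK HW) as [W' [HW' H]].
    (* If 1 - K - W were injective, its bounded inverse would contradict [Hn]. *)
    - apply NNPP. intros Hinj. apply Hn.
      destruct (compact_injective_inverse X (fun x => vadd (K x) (W x)))
        as [B HB].
      + apply compact_add_finite_rank; assumption.
      + intros x Hx. apply NNPP. intros Hx0. apply Hinj. eauto.
      + exists W, B. tauto.
    - exists (exist _ W' HW'). exact H. }
  apply choice in Hstep. destruct Hstep as [next Hnext].
  set (W0 := exist _ _ (finite_rank_zero X X) : Ty).
  set (V := fun n => ker (Nat.iter n next W0)).
  assert (Hmono : forall k x, V (S k) x -> V k x) by (intros k; apply Hnext).
  assert (HV : forall k, closed_subspace X (V k)).
  { intros k. unfold V, ker. destruct (Nat.iter k next W0) as [W HW]; simpl.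
    apply (closed_subspace_ker X X (fun x => vsub x (vadd (K x) (W x)))).
    apply (blin_id_minus X (fun x => vadd (K x) (W x))).
    apply compact_add_finite_rank; assumption. }
  apply (compact_no_descending_chain X K V HK HV Hmono).
  - intros k x Hx.
    (* Since [W0] is zero, V 0 is ker(1 - K) and contains every V k; so 1 - K maps V k to 0, which
       lies in V (k+1). *)
    assert (H0 : V 0%nat x) by (induction k; auto).
    replace (vsub x (K x)) with (vzero : X); [apply HV|].
    rewrite <- H0. simpl. vlin.
  - intros k. apply Hnext.
Qed.

(** * Operator ideals *)

Lemma vsum_ext (X : NData) (n : nat) (g h : nat -> X) :
  (forall j, (j < n)%nat -> g j = h j) -> vsum X n g = vsum X n h.
Proof.
  induction n as [|n IH]; intros H; simpl; [reflexivity|].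
  rewrite IH, H by auto. reflexivity.
Qed.

Lemma vsum_blin (X Y : Banach) (f : X -> Y) (n : nat) (g : nat -> X) :
  is_bounded_linear X Y f -> f (vsum X n g) = vsum Y n (fun j => f (g j)).
Proof.
  intros Hf. induction n as [|n IH]; simpl; [apply (blin_zero X Y f Hf)|].
  rewrite (proj1 Hf), IH. reflexivity.
Qed.

Lemma vsum_split (X : Banach) (n m : nat) (g : nat -> X) :
  vsum X (n + m) g = vadd (vsum X n g) (vsum X m (fun j => g (n + j)%nat)).
Proof.
  induction m as [|m IH].
  - rewrite Nat.add_0_r. simpl. symmetry; apply add_zero.
  - rewrite Nat.add_succ_r. simpl. rewrite IH. symmetry; apply add_assoc.
Qed.

Lemma in_ideal_ext (X Y : Banach) (T : X -> Y) (Z1 Z2 : Banach) (A A' : Z1 -> Z2) :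
  (forall z, A z = A' z) -> in_ideal X Y T Z1 Z2 A -> in_ideal X Y T Z1 Z2 A'.
Proof.
  intros H [n [P [Q [HP [HQ HA]]]]]. exists n, P, Q.
  split; [exact HP|]. split; [exact HQ|]. intros z. rewrite <- H. apply HA.
Qed.

Lemma in_ideal_zero (X Y : Banach) (T : X -> Y) (Z1 Z2 : Banach) :
  in_ideal X Y T Z1 Z2 (fun _ => vzero).
Proof.
  exists 0%nat, (fun _ _ => vzero), (fun _ _ => vzero).
  split; [|split]; intros; [apply blin_const_zero|apply blin_const_zero|reflexivity].
Qed.

Lemma in_ideal_gen (X Y : Banach) (T : X -> Y) (Z1 Z2 : Banach)
    (P : Y -> Z2) (Q : Z1 -> X) :
  is_bounded_linear Y Z2 P -> is_bounded_linear Z1 X Q ->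
  in_ideal X Y T Z1 Z2 (fun z => P (T (Q z))).
Proof.
  intros HP HQ. exists 1%nat, (fun _ => P), (fun _ => Q).
  split; [auto|]. split; [auto|]. intros z. simpl. vlin.
Qed.

Lemma in_ideal_add (X Y : Banach) (T : X -> Y) (Z1 Z2 : Banach) (A A' : Z1 -> Z2) :
  in_ideal X Y T Z1 Z2 A -> in_ideal X Y T Z1 Z2 A' ->
  in_ideal X Y T Z1 Z2 (fun z => vadd (A z) (A' z)).
Proof.
  intros [n [P [Q [HP [HQ HA]]]]] [n' [P' [Q' [HP' [HQ' HA']]]]].
  exists (n + n')%nat,
    (fun j => if Nat.ltb j n then P j else P' (j - n)%nat),
    (fun j => if Nat.ltb j n then Q j else Q' (j - n)%nat).
  split; [intros j; destruct (Nat.ltb j n); auto|].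
  split; [intros j; destruct (Nat.ltb j n); auto|].
  intros z. rewrite vsum_split, HA, HA'. f_equal; apply vsum_ext; intros j Hj.
  - apply Nat.ltb_lt in Hj. rewrite Hj. reflexivity.
  - replace (Nat.ltb (n + j) n) with false by (symmetry; apply Nat.ltb_ge; lia).
    replace (n + j - n)%nat with j by lia. reflexivity.
Qed.

Lemma in_ideal_comp (X Y : Banach) (T : X -> Y) (Z1 Z2 W1 W2 : Banach)
    (A : Z1 -> Z2) (P : Z2 -> W2) (Q : W1 -> Z1) :
  is_bounded_linear Z2 W2 P -> is_bounded_linear W1 Z1 Q ->
  in_ideal X Y T Z1 Z2 A -> in_ideal X Y T W1 W2 (fun z => P (A (Q z))).
Proof.
  intros HP HQ [n [R [R' [HR [HR' HA]]]]].
  exists n, (fun j y => P (R j y)), (fun j z => R' j (Q z)). split; [|split].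
  - intros j. apply (blin_comp Y W2 Z2 (R j) P); auto.
  - intros j. apply (blin_comp W1 X Z1 Q (R' j)); auto.
  - intros z. rewrite HA. apply (vsum_blin Z2 W2 P n _ HP).
Qed.

(** Reduces an inclusion of ideals to membership of the generator. *)
Lemma in_ideal_trans (X Y X' Y' : Banach) (T : X -> Y) (S : X' -> Y')
    (Z1 Z2 : Banach) (A : Z1 -> Z2) :
  in_ideal X' Y' S X Y T -> in_ideal X Y T Z1 Z2 A -> in_ideal X' Y' S Z1 Z2 A.
Proof.
  intros HT [n [P [Q [HP [HQ HA]]]]].
  apply (in_ideal_ext _ _ _ _ _ (fun z => vsum Z2 n (fun j => P j (T (Q j z))))).
  { intros z. symmetry; apply HA. }
  clear HA. induction n as [|n IH]; simpl; [apply in_ideal_zero|].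
  apply in_ideal_add; [exact IH|]. apply (in_ideal_comp _ _ _ X Y); auto.
Qed.

(** With g(S x0) = 1, the rank-one operator f(.) z equals R S R', where R' = f(.) x0 and R = g(.)
    z. *)
Lemma finite_rank_in_ideal (X Y : Banach) (S : X -> Y) (Z1 Z2 : Banach) (W : Z1 -> Z2) :
  nonzero_op X Y S -> is_bounded_linear X Y S -> finite_rank Z1 Z2 W ->
  in_ideal X Y S Z1 Z2 W.
Proof.
  intros [x0 Hx0] HS HW. destruct (hahn_banach Y (S x0) Hx0) as [g [Hg Hgx0]].
  induction HW as [|W f z HW IH Hf]; [apply in_ideal_zero|].
  apply in_ideal_add; [exact IH|].
  apply (in_ideal_ext _ _ _ _ _ (fun w => vscal (g (S (vscal (f w) x0))) z)).
  - intros w. rewrite (proj1 (proj2 HS)), (proj1 (proj2 Hg)), Hgx0.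
    f_equal. apply Cplx_eq; simpl; ring.
  - apply (in_ideal_gen _ _ S _ _ (fun y => vscal (g y) z) (fun w => vscal (f w) x0));
      apply blin_rank_one; assumption.
Qed.

(** * Equivalence after extension *)

Lemma blin_fst (X Y : Banach) : is_bounded_linear (dsum X Y) X fst.
Proof.
  repeat split. exists 1. intros [x y]; simpl. rewrite Rmult_1_l.
  rewrite <- (sqrt_square (vnorm x)) at 1 by apply norm_nonneg.
  apply sqrt_le_1_alt. generalize (norm_nonneg Y y). nra.
Qed.

Lemma blin_snd (X Y : Banach) : is_bounded_linear (dsum X Y) Y snd.
Proof.
  repeat split. exists 1. intros [x y]; simpl. rewrite Rmult_1_l.
  rewrite <- (sqrt_square (vnorm y)) at 1 by apply norm_nonneg.
  apply sqrt_le_1_alt. generalize (norm_nonneg X x). nra.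
Qed.

Lemma blin_inl (X Y : Banach) :
  is_bounded_linear X (dsum X Y) (fun x => (x, vzero)).
Proof.
  repeat split; simpl.
  - intros. f_equal. symmetry; apply add_zero.
  - intros. f_equal. symmetry; apply vscal_zero.
  - exists 1. intros x. rewrite norm_zero, Rmult_0_l, Rplus_0_r, sqrt_square
      by apply norm_nonneg. lra.
Qed.

Lemma blin_inr (X Y : Banach) :
  is_bounded_linear Y (dsum X Y) (fun y => (vzero, y)).
Proof.
  repeat split; simpl.
  - intros. f_equal. symmetry; apply add_zero.
  - intros. f_equal. symmetry; apply vscal_zero.
  - exists 1. intros x. rewrite norm_zero, Rmult_0_l, Rplus_0_l, sqrt_square
      by apply norm_nonneg. lra.
Qed.

Lemma dsum_norm_nonneg (X Y : Banach) (p : dsum X Y) : 0 <= vnorm p.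
Proof. apply sqrt_pos. Qed.

(** [blin_comp] wants a [Banach] space in the middle, while [dsum] is bare [NData]; only the
    nonnegativity of its norm matters here. *)
Lemma blin_comp_dsum (X1 X2 Y1 Y2 X Y : Banach) (i : X -> dsum X1 X2)
    (f : dsum X1 X2 -> dsum Y1 Y2) (p : dsum Y1 Y2 -> Y) :
  is_bounded_linear X (dsum X1 X2) i -> is_bounded_linear (dsum X1 X2) (dsum Y1 Y2) f ->
  is_bounded_linear (dsum Y1 Y2) Y p -> is_bounded_linear X Y (fun x => p (f (i x))).
Proof.
  intros [ia [iscal [L HL]]] [fa [fs [M HM]]] [pa [ps [N HN]]]. repeat split.
  - intros. rewrite ia, fa, pa. reflexivity.
  - intros. rewrite iscal, fs, ps. reflexivity.
  - exists (Rmax N 0 * (Rmax M 0 * L)). intros x.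
    eapply Rle_trans; [apply HN|].
    generalize (dsum_norm_nonneg Y1 Y2 (f (i x))) (dsum_norm_nonneg X1 X2 (i x)).
    generalize (HM (i x)) (HL x) (Rmax_l N 0) (Rmax_r N 0) (Rmax_l M 0) (Rmax_r M 0).
    set (a := vnorm (f (i x))). set (b := vnorm (i x)). intros.
    apply Rle_trans with (Rmax N 0 * a); [apply Rmult_le_compat_r; lra|].
    rewrite Rmult_assoc. apply Rmult_le_compat_l; [lra|].
    apply Rle_trans with (Rmax M 0 * b).
    { apply Rle_trans with (M * b); [lra|apply Rmult_le_compat_r; lra]. }
    rewrite Rmult_assoc. apply Rmult_le_compat_l; lra.
Qed.

Lemma equiv_after_ext_sym (X Y : Banach) (T : X -> X) (S : Y -> Y) :
  equiv_after_ext X Y T S -> equiv_after_ext Y X S T.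
Proof.
  intros [X' [Y' [E [F [[HE [G [HG [GE EG]]]] [[HF [H [HH [HF' FH]]]] Heq]]]]]].
  exists Y', X', G, H. split; [|split].
  - split; [exact HG|]. exists E. auto.
  - split; [exact HH|]. exists F. auto.
  - intros p. rewrite Heq, GE, FH. reflexivity.
Qed.

(* The corner of [T + id = E (S + id) F] reads [T = E11 S F11 + E12 F21], while
   [(T + id) F^-1 = E (S + id)] gives [E12 = T H12] and
   [E^-1 (T + id) = (S + id) F] gives [F21 = G21 T]. *)
Lemma equiv_after_ext_corner (X Y : Banach) (T : X -> X) (S : Y -> Y) :
  is_bounded_linear Y Y S -> equiv_after_ext X Y T S ->
  exists (P : Y -> X) (Q : X -> Y) (N : X -> X),
    is_bounded_linear Y X P /\ is_bounded_linear X Y Q /\ is_bounded_linear X X N /\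
    forall x, T x = vadd (P (S (Q x))) (T (N (T x))).
Proof.
  intros HS [X' [Y' [E [F [[HE [G [HG [GE EG]]]] [[HF [H [HH [HF' FH]]]] Heq]]]]]].
  (* The three witnesses are E11, F11 and N = H12 G21, where G and H are the inverses of E and F. *)
  exists (fun y => fst (E (y, vzero))), (fun x => fst (F (x, vzero))),
    (fun x => fst (H (vzero, snd (G (x, vzero))))).
  split; [|split; [|split]].
  - eapply blin_comp_dsum; [apply blin_inl|exact HE|apply blin_fst].
  - eapply blin_comp_dsum; [apply blin_inl|exact HF|apply blin_fst].
  - apply (blin_comp X X Y' (fun x => snd (G (x, vzero))) (fun w => fst (H (vzero, w)))).
    + eapply blin_comp_dsum; [apply blin_inl|exact HG|apply blin_snd].
    + eapply blin_comp_dsum; [apply blin_inr|exact HH|apply blin_fst].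
  - intros x.
    assert (F21 : snd (G (T x, vzero)) = snd (F (x, vzero))).
    { change (T x, vzero) with (diag_id X X' T (x, vzero)).
      rewrite Heq, GE. reflexivity. }
    rewrite F21.
    assert (E12 : forall w, T (fst (H (vzero, w))) = fst (E (S vzero, w))).
    { intros w. transitivity (fst (diag_id X X' T (H (vzero, w)))); [reflexivity|].
      rewrite Heq, FH. reflexivity. }
    rewrite E12.
    transitivity (fst (diag_id X X' T (x, vzero))); [reflexivity|].
    rewrite Heq. unfold diag_id.
    set (p := F (x, vzero)). rewrite (blin_zero Y Y S HS).
    change (fst (E (S (fst p), snd p)) =
      fst (vadd (E (S (fst p), vzero)) (E (vzero, snd p)))).
    rewrite <- (proj1 HE). simpl. rewrite add_zero, add_comm, add_zero. reflexivity.
Qed.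

Lemma equiv_after_ext_in_ideal (X Y : Banach) (T : X -> X) (S : Y -> Y) :
  is_compact_op X X T -> is_bounded_linear Y Y S -> nonzero_op Y Y S ->
  equiv_after_ext X Y T S -> in_ideal Y Y S X X T.
Proof.
  intros HT HS HS0 Heq.
  destruct (equiv_after_ext_corner X Y T S HS Heq) as [P [Q [N [HP [HQ [HN E]]]]]].
  destruct (compact_finite_rank_left_inverse X (fun x => T (N x)))
    as [W [B [HW [HB HBW]]]].
  { apply (compact_comp X X X N T); assumption. }
  apply (in_ideal_ext _ _ _ _ _
    (fun x => vadd (B (P (S (Q x)))) (B (vopp (W (T x)))))).
  - intros x.
    assert (EP : P (S (Q x)) = vsub (T x) (T (N (T x)))).
    { apply (vadd_cancel X (T (N (T x)))). rewrite add_comm, <- E. vlin. }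
    rewrite <- (proj1 HB), EP.
    (* The left inverse is applied at the vector T x: T x = B(T x - K T x - W T x). *)
    etransitivity; [|apply (HBW (T x))]. f_equal. vlin.
  - apply in_ideal_add.
    + apply (in_ideal_gen Y Y S X X (fun y => B (P y)) Q); [|exact HQ].
      apply (blin_comp Y X X P B); assumption.
    + apply (in_ideal_comp Y Y S X X X X W (fun x => B (vopp x)) T).
      * apply (blin_comp X X X (fun x => vopp x) B); [|exact HB].
        apply (blin_opp_op X X (fun x => x)), blin_id.
      * apply HT.
      * apply finite_rank_in_ideal; assumption.
Qed.

Theorem theorem2p5 (X Y : Banach) (T : X -> X) (S : Y -> Y) :
  is_compact_op X X T -> nonzero_op X X T ->
  is_compact_op Y Y S -> nonzero_op Y Y S ->
  equiv_after_ext X Y T S ->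
  forall (Z1 Z2 : Banach) (A : Z1 -> Z2),
    in_ideal X X T Z1 Z2 A <-> in_ideal Y Y S Z1 Z2 A.
Proof.
  intros HT HT0 HS HS0 Heq Z1 Z2 A. split; apply in_ideal_trans.
  - apply equiv_after_ext_in_ideal; try assumption. apply HS.
  - apply equiv_after_ext_in_ideal; try assumption; [apply HT|].
    apply equiv_after_ext_sym; assumption.
Qed.
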